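(* Let $X$ be a Tychonoff space and let $\aleph_\alpha$ be an infinite cardinal. The cardinality of the set of all non-empty clopen subsets of $C_{\aleph_\alpha}(X)$ is either $1$ or at least $\mathfrak{c}$, where $\mathfrak{c}=2^{\aleph_0}$.
   Context: Tychonoff means completely regular and Hausdorff. $C(X)$ is the set of all real-valued continuous functions on $X$. For an infinite cardinal $\aleph_\alpha$, $\mathcal{A}_{\aleph_\alpha}=\{A\subseteq X: |A|<\aleph_\alpha\}$. For $f\in C(X)$, $A\in\mathcal{A}_{\aleph_\alpha}$ and real $\epsilon>0$ put $B(f,A,\epsilon)=\{g\in C(X): \sup_{x\in A}|f(x)-g(x)|<\epsilon\}$ (equal to $C(X)$ when $A=\emptyset$). The sets $B(f,A,\epsilon)$ form a base of a topology on $C(X)$; $C_{\aleph_\alpha}(X)$ denotes $C(X)$ with this topology. *)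

(* Defs.v *)
From HB Require Import structures.
From mathcomp Require Import all_boot all_order all_algebra.
From mathcomp Require Import all_classical all_reals all_analysis.
Import Order.TTheory GRing.Theory Num.Theory.
Import numFieldNormedType.Exports.

Set Implicit Arguments.
Unset Strict Implicit.
Unset Printing Implicit Defensive.

Local Open Scope classical_set_scope.
Local Open Scope ring_scope.

(* By uniform_separatorP, completely_regular_space is separation of points from
   closed sets by continuous functions into [0, 1]. *)
Definition tychonoff_space (X : topologicalType) : Prop :=
  completely_regular_space X /\ hausdorff_space X.

(* A cardinal is represented by a type of that cardinality; with choice, the
   cardinals of infinite types are exactly the alephs. *)
Record infinite_cardinal := InfiniteCardinal {
  cardinal_sort :> Type;
  cardinal_infinite : infinite_set [set: cardinal_sort]
}.

Definition card_lt T U (A : set T) (B : set U) : bool :=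
  (A #<= B)%card && ~~ (B #<= A)%card.

Section CardinalArithmetic.

Lemma card_le_rel T U (A : set T) (B : set U) (R : T -> U -> Prop) :
  (forall x, A x -> exists2 y, B y & R x y) ->
  (forall x x' y, A x -> A x' -> R x y -> R x' y -> x = x') ->
  (A #<= B)%card.
Proof.
move=> Rtot Rinj.
have h (x : A) : exists y : B, R (val x) (val y).
  have [y By Rxy] := Rtot _ (set_valP x).
  by exists (SigSub (mem_set By)).
have [f fR] := choice h.
apply/card_leP/injfunPex; exists f => // x x' _ _ fxx'.
apply: val_inj; apply: (Rinj _ _ (val (f x))); try exact: set_valP.
  exact: fR.
by rewrite fxx'; exact: fR.
Qed.

Lemma card_le_injP T U (A : set T) (B : set U) : (A #<= B)%card ->
  exists R : T -> U -> Prop,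
    (forall x, A x -> exists2 y, B y & R x y) /\
    (forall x x' y, A x -> A x' -> R x y -> R x' y -> x = x').
Proof.
move=> /card_leP/injfunPex[f _ finj].
exists (fun x y => exists (u : A), val u = x /\ val (f u) = y); split.
  move=> x Ax; exists (val (f (SigSub (mem_set Ax)))); first exact: set_valP.
  by exists (SigSub (mem_set Ax)).
move=> x x' y _ _ [u [<- fu]] [v [<- fv]].
congr val; apply: finj; rewrite ?inE//.
by apply: val_inj; rewrite fu fv.
Qed.

Lemma card_le_total T U (A : set T) (B : set U) :
  (A #<= B)%card \/ (B #<= A)%card.
Proof.
pose P (G : set (T * U)) :=
  [/\ G `<=` A `*` B,
      forall x y y', G (x, y) -> G (x, y') -> y = y' &
      forall x x' y, G (x, y) -> G (x', y) -> x = x'].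
have [F FP tF|G [[GAB Gfun Ginj] Gmax]] := @Zorn_bigcup _ P.
  split.
  - by move=> z [G FG Gz]; have [+ _ _] := FP _ FG; exact.
  - move=> x y y' [G FG Gz] [H FH Hz].
    have [GH|HG] := tF _ _ FG FH.
      by have [_ + _] := FP _ FH; apply; [exact: GH Gz|].
    by have [_ + _] := FP _ FG; apply; [exact: Gz|exact: HG].
  - move=> x y y' [G FG Gz] [H FH Hz].
    have [GH|HG] := tF _ _ FG FH.
      by have [_ _ +] := FP _ FH; apply; [exact: GH Gz|].
    by have [_ _ +] := FP _ FG; apply; [exact: Gz|exact: HG].
have [Gdom|] := pselect (forall x, A x -> exists y, G (x, y)).
  left; apply: (@card_le_rel _ _ _ _ (fun x y => G (x, y))).
    by move=> x /Gdom[y Gxy]; exists y => //; have [] := GAB _ Gxy.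
  by move=> x x' y _ _; exact: Ginj.
move=> /existsNP[a /not_implyP[Aa /forallNP Ga]].
have [Gcod|] := pselect (forall y, B y -> exists x, G (x, y)).
  right; apply: (@card_le_rel _ _ _ _ (fun y x => G (x, y))).
    by move=> y /Gcod[x Gxy]; exists x => //; have [] := GAB _ Gxy.
  by move=> y y' x _ _; exact: Gfun.
move=> /existsNP[b /not_implyP[Bb /forallNP Gb]].
exfalso; apply: (Gmax (G `|` [set (a, b)])).
  split; first by move=> z; left.
  by move=> /(_ (a, b)) Gab; apply: (Ga b); apply: Gab; right.
split.
- by move=> z [/GAB//|->].
- move=> x y y' [Gxy|[-> ->]] [Gxy'|[]].
  + exact: Gfun Gxy Gxy'.
  + by move=> xa; move: Gxy; rewrite xa => /Ga.
  + by move: Gxy' => /Ga.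
  + by move=> ->.
- move=> x x' y [Gxy|[-> ->]] [Gxy'|[]].
  + exact: Ginj Gxy Gxy'.
  + by move=> _ yb; move: Gxy; rewrite yb => /Gb.
  + by move: Gxy' => /Gb.
  + by move=> ->.
Qed.

Lemma infinite_card_double T (A : set T) : infinite_set A ->
  (A `*` [set: bool] #<= A)%card.
Proof.
move=> Ainf.
pose P (F : set (nat -> T)) :=
  [/\ forall f, F f -> injective f /\ range f `<=` A &
      forall f g m n, F f -> F g -> f m = g n -> f = g].
have [F FP tF|F [[Finj Fdisj] Fmax]] := @Zorn_bigcup _ P.
  split; first by move=> f [G FG Gf]; have [+ _] := FP _ FG; exact.
  move=> f g m n [G FG Gf] [H FH Hg].
  have [GH|HG] := tF _ _ FG FH.
    by have [_ +] := FP _ FH; apply => //; exact: GH.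
  by have [_ +] := FP _ FG; apply => //; exact: HG.
pose U := \bigcup_(f in F) range f.
have ADU (f : nat -> T) : range f `<=` A `\` U -> ~ injective f.
  move=> fAU finj; apply: (Fmax (F `|` [set f])).
    split; first by move=> g; left.
    move=> /(_ f) Ff; have {}Ff : F f by apply: Ff; right.
    have [_] := fAU (f 0%N) (imageT f 0%N).
    by apply; exists f => //; exact: imageT.
  split.
    move=> g [/Finj//|->]; split => //.
    by apply: (subset_trans fAU) => ? [].
  move=> g h m n [Fg|->] [Fh|->]//.
  - exact: Fdisj.
  - move=> gh; have [_ []] := fAU (f n) (imageT f n).
    by exists g => //; exists m.
  - move=> gh; have [_ []] := fAU (f m) (imageT f m).
    by exists h => //; exists n.
have Sfin : finite_set (A `\` U).
  apply: contrapT => /infiniteP/card_leP/injfunPex[f _ finj].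
  apply: (ADU (fun n => val (f (to_setT n)))).
    by move=> _ [n _ <-]; exact: set_valP.
  move=> m n /val_inj /(finj _ _ (mem_set I) (mem_set I)).
  exact: (congr1 val).
have [f0 Ff0] : exists f, F f.
  apply: contrapT => /forallNP F0; apply: Ainf.
  by apply: sub_finite_set Sfin => x Ax; split => // -[f /F0].
have [m /card_eqPle[/card_le_injP[s [stot sinj]] _]] := Sfin.
pose R (z : T * bool) (y : T) :=
  (exists f n, [/\ F f, z.1 = f n & y = f (m.*2 + (n.*2 + z.2))%N]) \/
  (exists i, [/\ (A `\` U) z.1, (i < m)%N, s z.1 i & y = f0 (i.*2 + z.2)%N]).
have odd_half i j (b c : bool) : (i.*2 + b = j.*2 + c)%N -> i = j /\ b = c.
  move=> e; have e1 := congr1 odd e; have e2 := congr1 half e.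
  move: e1 e2; rewrite ![(_.*2 + _)%N]addnC !oddD !odd_double !addbF !oddb.
  by rewrite !half_bit_double.
apply: (@card_le_rel _ _ _ _ R).
  move=> [x b] [/= Ax _]; have [[f Ff [n _ fnx]]|Ux] := pselect (U x).
    exists (f (m.*2 + (n.*2 + b)))%N; first by apply: (Finj _ Ff).2; exists (m.*2 + (n.*2 + b))%N.
    by left; exists f, n.
  have [i im sxi] := stot _ (conj Ax Ux).
  exists (f0 (i.*2 + b)%N); first by apply: (Finj _ Ff0).2; exists (i.*2 + b)%N.
  by right; exists i.
have small i (b : bool) : (i < m)%N -> (i.*2 + b < m.*2)%N.
  by move=> im; apply: (@leq_trans i.+1.*2); [rewrite doubleS; case: b; rewrite ?addn1 ?addn0//|rewrite leq_double].
move=> [x b] [x' b'] y _ _ [[f [n [/= Ff xf yf]]]|[i [/= Sx im sxi yf]]]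
  [[g [k [/= Fg xg yg]]]|[j [/= Sx' jm sxj yg]]].
- move: yf; rewrite {}yg => e; have fg := Fdisj _ _ _ _ Fg Ff e.
  move: e; rewrite fg => /(Finj _ Ff).1 /addnI /odd_half[kn ->].
  by rewrite xf xg fg kn.
- move: yf; rewrite {}yg => e; have fg := Fdisj _ _ _ _ Ff0 Ff e.
  move: e; rewrite fg => /(Finj _ Ff).1 e.
  by have := small _ b' jm; rewrite e ltnNge leq_addr.
- move: yf; rewrite {}yg => e; have fg := Fdisj _ _ _ _ Fg Ff0 e.
  move: e; rewrite fg => /(Finj _ Ff0).1 e.
  by have := small _ b im; rewrite -e ltnNge leq_addr.
- move: yf; rewrite {}yg => /(Finj _ Ff0).1 /odd_half[ji ->].
  by rewrite ji in sxj; rewrite (sinj _ _ _ Sx Sx' sxi sxj).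
Qed.

Lemma card_leU T (A B : set T) : (A #<= B)%card ->
  (A `|` B #<= B `*` [set: bool])%card.
Proof.
move=> /card_le_injP[s [stot sinj]].
apply: (@card_le_rel _ _ _ _ (fun x z =>
  (B x /\ z = (x, true)) \/ (A x /\ ~ B x /\ s x z.1 /\ z.2 = false))).
  move=> x ABx; have [Bx|Bx] := pselect (B x).
    by exists (x, true) => //; left.
  have Ax : A x by case: ABx.
  by have [y By sxy] := stot _ Ax; exists (y, false) => //; right.
move=> x x' [y b] _ _ [[Bx [-> ->]]|[Ax [Bx [/= sx ->]]]]
  [[Bx' []]|[Ax' [Bx' [/= sx' ]]]]//.
by move=> _; exact: sinj sx sx'.
Qed.

Lemma infinite_cardinal_ltU (k : infinite_cardinal) T (A B : set T) :
  card_lt A [set: k] -> card_lt B [set: k] -> card_lt (A `|` B) [set: k].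
Proof.
wlog AB : A B / (A #<= B)%card.
  move=> wl kA kB; have [AB|BA] := card_le_total A B; first exact: wl.
  by rewrite setUC; exact: wl.
move=> _ /andP[Bk kB].
have [Bfin|Binf] := pselect (finite_set B).
  have ABfin : finite_set (A `|` B).
    by rewrite finite_setU; split => //; exact: card_le_finite AB Bfin.
  have kAB : ~ ([set: k] #<= A `|` B)%card.
    by move=> /card_le_finite /(_ ABfin); exact: cardinal_infinite.
  apply/andP; split; last exact/negP.
  by have [//|/kAB] := card_le_total (A `|` B) [set: k].
have ABB : (A `|` B #<= B)%card.
  exact: card_le_trans (card_leU AB) (infinite_card_double Binf).
apply/andP; split; first exact: card_le_trans ABB Bk.
by apply: contra kB => /card_le_trans; exact.
Qed.

Lemma infinite_cardinal_lt0 (k : infinite_cardinal) T :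
  card_lt (@set0 T) [set: k].
Proof.
rewrite /card_lt card_ge0/=; apply/negP => /card_le_finite.
by move=> /(_ (finite_set0 _)); exact: cardinal_infinite.
Qed.

End CardinalArithmetic.

(* C(X); the parameter k only selects the topology declared below, which has
   the balls Cball f A e with |A| < k and 0 < e as a base. *)
Definition Cspace (R : realType) (X : topologicalType)
  (k : infinite_cardinal) : Type := continuousType X R.

HB.instance Definition _ (R : realType) (X : topologicalType)
    (k : infinite_cardinal) :=
  Choice.copy (Cspace R X k) (continuousType X R).

HB.instance Definition _ (R : realType) (X : topologicalType)
    (k : infinite_cardinal) :=
  isPointed.Build (Cspace R X k) (cst (0 : R) : continuousType X R).

Section CspaceTopology.
Context {R : realType} {X : topologicalType} {k : infinite_cardinal}.
Implicit Types (f g h : Cspace R X k) (A : set X) (e : R).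

(* The supremum is taken in the extended reals: it is +oo when f - g is
   unbounded on A, and -oo when A is empty. *)
Definition Cball f A e : set (Cspace R X k) :=
  [set g : Cspace R X k |
    (ereal_sup [set `|(f : continuousType X R) x
                     - (g : continuousType X R) x|%:E | x in A] < e%:E)%E].

Lemma CballP f A e g : Cball f A e g <->
  exists2 r : R, r < e &
    forall x, A x -> `|(f : continuousType X R) x
                      - (g : continuousType X R) x| <= r.
Proof.
rewrite /Cball /=; set S := [set _ | _ in _]; split.
  move=> Se; have [r [re Sr]] : exists r : R, r < e /\ (ereal_sup S <= r%:E)%E.
    move: Se; case: (ereal_sup S) => [s|//|_].
      by rewrite lte_fin => se; exists s.
    by exists (e - 1); rewrite leNye gtrBl.
  exists r => // x Ax; rewrite -lee_fin; apply: le_trans Sr.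
  by apply: ereal_sup_ubound; exists x.
move=> [r re Sr]; apply: (@le_lt_trans _ _ r%:E); last by rewrite lte_fin.
by apply: ge_ereal_sup => _ [x Ax <-]; rewrite lee_fin; exact: Sr.
Qed.

Lemma Cball_center f A e : 0 < e -> Cball f A e f.
Proof. by move=> e0; apply/CballP; exists 0 => // x _; rewrite subrr normr0. Qed.

Lemma Cball_sub f A e h : Cball f A e h ->
  exists2 d : R, 0 < d & Cball h A d `<=` Cball f A e.
Proof.
move=> /CballP[r re fh]; exists (e - r); first by rewrite subr_gt0.
move=> g /CballP[s sd hg]; apply/CballP; exists (r + s).
  by rewrite addrC -ltrBrDr.
move=> x Ax; rewrite (le_trans (ler_distD (h x) _ _))// lerD//.
  exact: fh.
exact: hg.
Qed.

Lemma Cball_le f A B (d e : R) : A `<=` B -> d <= e ->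
  Cball f B d `<=` Cball f A e.
Proof.
move=> AB de g /CballP[r rd fg]; apply/CballP; exists r => [|x /AB]; last exact: fg.
exact: lt_le_trans de.
Qed.

Definition Cindex : set (Cspace R X k * set X * R) :=
  [set i | card_lt i.1.2 [set: k] /\ 0 < i.2].

Definition Cbase (i : Cspace R X k * set X * R) : set (Cspace R X k) :=
  Cball i.1.1 i.1.2 i.2.

Lemma Cbase_cover : \bigcup_(i in Cindex) Cbase i = setT.
Proof.
apply/seteqP; split => // f _; exists (f, set0, 1).
  by split => //=; exact: infinite_cardinal_lt0.
exact: Cball_center.
Qed.

Lemma Cbase_join i j t : Cindex i -> Cindex j -> Cbase i t -> Cbase j t ->
  exists l, [/\ Cindex l, Cbase l t & Cbase l `<=` Cbase i `&` Cbase j].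
Proof.
case: i => [[f A] d]; case: j => [[g B] e] [/= kA d0] [/= kB e0].
move=> /Cball_sub[r r0 rA] /Cball_sub[s s0 sB].
exists (t, A `|` B, Order.min r s); split.
- by split => /=; [exact: infinite_cardinal_ltU|rewrite lt_min r0].
- by apply: Cball_center; rewrite /= lt_min r0.
- rewrite subsetI; split.
    by apply: subset_trans rA; apply: Cball_le; rewrite ?ge_min ?lexx// => x; left.
  by apply: subset_trans sB; apply: Cball_le; rewrite ?ge_min ?lexx ?orbT// => x; right.
Qed.

HB.instance Definition _ :=
  isBaseTopological.Build (Cspace R X k) Cbase_cover Cbase_join.

Lemma Cspace_openE (U : set (Cspace R X k)) : open U <->
  exists2 D, D `<=` Cindex & \bigcup_(i in D) Cbase i = U.
Proof. by []. Qed.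

End CspaceTopology.

(* Main.v *)
(** [C_k(X)] is a topological group under addition, though in general not a
topological vector space. If every continuous function is bounded on every set
of size [< k], the segments [t |-> f + t (g - f)] are continuous, so that
[C_k(X)] is connected. Otherwise some [h] is unbounded on some [A] of size
[< k]. The functions bounded on [A] form an open subgroup, whose cosets through
the multiples [n h] are pairwise distinct; every union of cosets of an open
subgroup is clopen, which gives [2^aleph_0] clopen sets. *)

Require Import Defs.
From mathcomp Require Import all_boot all_order all_algebra.
From mathcomp Require Import all_classical all_reals all_analysis.
From mathcomp Require Import ring.
Import Order.TTheory GRing.Theory Num.Theory.
Import numFieldNormedType.Exports.
Local Open Scope classical_set_scope.
Local Open Scope card_scope.

Definition bounded_on {R : realType} {X : Type} (A : set X) (h : X -> R) :=
  exists M : R, forall x, A x -> (`|h x| <= M)%R.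

Section BoundedOn.
Set Implicit Arguments.
Unset Strict Implicit.
Local Open Scope ring_scope.
Context {R : realType} {X : Type} (A : set X).
Implicit Types f g h : X -> R.

Lemma bounded_onB f g :
  bounded_on A f -> bounded_on A g -> bounded_on A (fun x => f x - g x).
Proof.
move=> [M fM] [N gN]; exists (M + N) => x Ax.
by rewrite (le_trans (ler_normB _ _))// lerD ?fM ?gN.
Qed.

Lemma bounded_on_mull (c : R) h : c != 0 ->
  bounded_on A (fun x => c * h x) -> bounded_on A h.
Proof.
move=> c0 [M hM]; exists (M / `|c|) => x Ax.
by rewrite ler_pdivlMr ?normr_gt0// mulrC -normrM hM.
Qed.

End BoundedOn.

Section Clopens.
Set Implicit Arguments.
Unset Strict Implicit.
Local Open Scope ring_scope.
Context {R : realType} {X : topologicalType} {k : infinite_cardinal}.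
Local Notation C := (Cspace R X k).
Local Notation fn f := ((f : continuousType X R) : X -> R).
Implicit Types (f g h : C) (A : set X) (U : set C).

(** A base ball contains, around each of its points, a ball over the same [A], so neighbourhoods can
    be taken centred. *)
Lemma Cspace_openP U : open U <-> forall f, U f ->
  exists A (e : R), [/\ card_lt A [set: k], 0 < e & Cball f A e `<=` U].
Proof.
rewrite Cspace_openE; split.
  move=> [D DC <-] f [[[g A] e] Di]; have [/= kA _] := DC _ Di.
  move=> /Cball_sub[d d0 sub]; exists A, d; split => //.
  by apply: (subset_trans sub) => h Bh; exists (g, A, e).
move=> H; exists [set i | Cindex i /\ Cbase i `<=` U]; first by move=> i [].
apply/seteqP; split; first by move=> f [i [_ iU] /iU].
move=> f /H[A [e [kA e0 sub]]]; exists (f, A, e); first by split.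
exact: Cball_center.
Qed.

Lemma continuous_line f h (t : R) : continuous (fun x => fn f x + t * fn h x).
Proof.
move=> x; apply: cvgD; first exact: cts_fun.
by apply: cvgM; [exact: cvg_cst|exact: cts_fun].
Qed.

Definition Cline f h (t : R) : C := mkcts (@continuous_line f h t).

Lemma ClineE f h t x : fn (Cline f h t) x = fn f x + t * fn h x.
Proof. by []. Qed.

Lemma CspaceP f g : fn f =1 fn g -> f = g.
Proof. by move=> fg; apply/continuousEP. Qed.

(** If [|h| <= M] on [A], the functions at parameters [t] and [s] differ on [A] by at most
    [|t - s| * M], so the line depends continuously on [t]. *)
Lemma open_Cline_preimage f h U :
  (forall A, card_lt A [set: k] -> bounded_on A (fn h)) ->
  open U -> open [set t | U (Cline f h t)].
Proof.
move=> hbnd /Cspace_openP oU; rewrite openE => t /= /oU[A [e [kA e0 sub]]].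
have [M hM] := hbnd _ kA.
(* [M] need not be positive; [1 + |M|] is a bound one can divide by. Halving [e] below leaves the
   strict inequality that [CballP] asks for. *)
have M0 : 0 < 1 + `|M| by rewrite ltr_pwDl.
apply/nbhs_ballP; exists (e / 2 / (1 + `|M|)) => /=; first by rewrite !divr_gt0.
move=> s; rewrite /ball/= ltr_pdivlMr// => ts; apply: sub; apply/CballP.
exists (e / 2); first by rewrite ltr_pdivrMr// mulr_natr mulr2n ltrDl.
move=> x Ax /=; apply: le_trans (ltW ts).
have -> : fn f x + t * fn h x - (fn f x + s * fn h x) = (t - s) * fn h x by ring.
rewrite normrM ler_wpM2l// (le_trans (hM _ Ax))//.
by rewrite (le_trans (ler_norm M))// lerDr.
Qed.

(** The parameters at which the line from a point of [U] to any [g] meets [U] form a non-empty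
    clopen subset of the connected space [R]. *)
Lemma clopen_Cspace_setT U :
  (forall A h, card_lt A [set: k] -> bounded_on A (fn h)) ->
  clopen U -> U !=set0 -> U = setT.
Proof.
move=> bnd [oU cU] [f Uf]; apply/seteqP; split => // g _.
(* This is [g - f], so the line is at [f] for parameter [0] and at [g] for parameter [1]. *)
pose h : C := Cline g f (-1).
pose P := [set t | U (Cline f h t)].
have hbnd A : card_lt A [set: k] -> bounded_on A (fn h) by exact: bnd.
have cR : connected [set: R] by apply/connected_intervalP.
have PT : P = setT.
  apply: cR.
  - by exists 0; rewrite /P/=; congr U: Uf; apply: CspaceP => x; rewrite !ClineE; ring.
  - by exists P; rewrite ?setTI//; exact: open_Cline_preimage.
  - exists P; rewrite ?setTI// -openC.
    by apply: (@open_Cline_preimage f h (~` U)) => //; rewrite openC.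
have : P 1 by rewrite PT.
by rewrite /P/=; congr U; apply: CspaceP => x; rewrite !ClineE; ring.
Qed.

(* [U] is a union of cosets of the subgroup of functions bounded on [A]. *)
Lemma clopen_saturated A U : card_lt A [set: k] ->
  (forall f g, bounded_on A (fun x => fn f x - fn g x) -> U f -> U g) ->
  clopen U.
Proof.
move=> kA.
have sat_open V :
    (forall f g, bounded_on A (fun x => fn f x - fn g x) -> V f -> V g) ->
    open V.
  (* Any radius would do: a finite uniform distance on [A] already makes the difference bounded
     there. *)
  move=> Vsat; apply/Cspace_openP => f Vf; exists A, 1; split => //.
  by move=> g /CballP[r _ fg]; apply: Vsat Vf; exists r.
move=> Usat; split; first exact: sat_open.
(* Having a bounded difference is symmetric, so the complement is saturated too. *)
rewrite -openC; apply: sat_open => f g [M fgM] nUf Ug; apply: nUf.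
by apply: Usat Ug; exists M => x Ax; rewrite distrC fgM.
Qed.

Definition coset_union A h (S : set nat) : set C :=
  [set g | exists2 n, S n & bounded_on A (fun x => fn g x - n%:R * fn h x)].

Lemma clopen_coset_union A h S : card_lt A [set: k] ->
  clopen (coset_union A h S).
Proof.
move=> kA; apply: (@clopen_saturated A) => // f g fg [n Sn fn]; exists n => //.
have [M H] := bounded_onB fn fg; exists M => x /H.
by congr (`|_| <= _); ring.
Qed.

(** If [n h] and [m h] shared a coset with [n <> m], dividing by [n - m] would bound [h] on [A].
    Hence the union of cosets determines [S]. *)
Lemma multiple_coset_union A h S n : ~ bounded_on A (fn h) ->
  coset_union A h S (Cline (cst 0 : continuousType X R) h n%:R) <-> S n.
Proof.
move=> unb; split => [[m Sm H]|Sn]; last first.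
  by exists n => //; exists 0 => x _; rewrite ClineE /= /cst add0r subrr normr0.
suff -> : n = m by [].
apply/eqP; rewrite -(eqr_nat R) -subr_eq0; apply/negPn/negP => nm; apply: unb.
apply: (bounded_on_mull nm); have [M HM] := H; exists M => x /HM; rewrite ClineE /= /cst.
by congr (`|_| <= _); ring.
Qed.

End Clopens.

Theorem mainTheorem6 (R : realType) (X : topologicalType)
    (k : infinite_cardinal) (X_tychonoff : tychonoff_space X) :
  let clopens := [set U : set (Cspace R X k) | clopen U /\ U !=set0] in
  clopens #= `I_1 \/ [set: set nat] #<= clopens.
Proof.
move=> clopens.
have [bnd|] := pselect (forall A (h : Cspace R X k), card_lt A [set: k] ->
    bounded_on A ((h : continuousType X R) : X -> R)).
  left; suff -> : clopens = [set setT] by exact: card_set1.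
  apply/seteqP; split => [U [cU U0]|_ ->]; first exact: clopen_Cspace_setT.
  by split; [exact: clopenT|exists point].
move=> /existsNP[A /existsNP[h /not_implyP[kA unb]]]; right.
(* Adjoining [0] keeps the union of cosets non-empty. *)
pose S0 (S : set nat) : set nat := [set n | if n is m.+1 then S m else True].
apply: (@card_le_rel _ _ _ _ (fun S U => U = coset_union A h (S0 S))).
  move=> S _; exists (coset_union A h (S0 S)) => //; split.
    exact: clopen_coset_union.
  (* The multiple with index [0] is always a member. *)
  by eexists; exact/(multiple_coset_union (S0 S) 0 unb).
(* [S0] shifts indices by one, so membership of [n] is tested at the multiple [n + 1] of [h]. *)
move=> S T U _ _ -> ST; apply/seteqP; split=> n Sn.
  by apply/(multiple_coset_union (S0 T) n.+1 unb); rewrite -ST; exact/multiple_coset_union.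
by apply/(multiple_coset_union (S0 S) n.+1 unb); rewrite ST; exact/multiple_coset_union.
Qed.
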